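(* Let $x,\rho$ be complex numbers (or indeterminates), and let $(a_{i,j})_{i,j\ge0}$ be the sequence defined by the recurrence $$a_{i,j}=a_{i-1,j}+a_{i,j-1}+x\,a_{i-1,j-1},\qquad i,j\ge1,$$ together with the initial conditions $a_{i,i}=0$ for $i\ge0$, and $a_{i,0}=\rho^{i-1}$, $a_{0,i}=-\rho^{i-1}$ for $i\ge1$. Then for every integer $n\ge1$, $$\det_{0\le i,j\le 2n-1}(a_{i,j})=(1+x)^{2(n-1)^2}\,(x+\rho)^{2n-2}.$$ *)

(* Defs.v *)
From mathcomp Require Export all_boot all_order all_algebra.

Set Implicit Arguments.
Unset Strict Implicit.
Unset Printing Implicit Defensive.

(* Main.v *)
Require Import Defs.
From mathcomp Require Import all_boot all_order all_algebra.
From mathcomp Require Import ring zify.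
Import GRing.Theory.
Local Open Scope ring_scope.

Set Implicit Arguments.
Unset Strict Implicit.

(** The generating function of [a] is
    [(u-v) / ((1-rho u)(1-rho v)) * (1 + (x+rho) u v / (1-u-v-x u v))].
    Substituting [u/(1+u)], [v/(1+v)] for [u], [v] and dropping factors depending
    on one variable only turns it into
    [(u-v) (1 + (x+rho) u v / (1-(1+x) u v))], whose coefficients form a
    tridiagonal skew-symmetric matrix [T].  In terms of matrices, [A = L T L^T],
    where [L] is the unitriangular array with [k]-th column
    [u^k (1-u)^(1-k) / (1-rho u)]. *)

Definition skew_tridiag {R : pzRingType} (d : nat -> R) m : 'M[R]_m :=
  \matrix_(i, j) ((i == j.+1 :> nat)%:R * d j - (j == i.+1 :> nat)%:R * d i).

(** Row [0] has the single entry [- d 0] in column [1]; in its minor, column [0] has the single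
    entry [d 0]. The cofactor sign [-1] makes the product [d 0 ^+ 2]. *)
Lemma det_skew_tridiag_rec (R : comNzRingType) (d : nat -> R) m :
  \det (skew_tridiag d m.+2)
    = d 0%N ^+ 2 * \det (skew_tridiag (fun k => d k.+2) m).
Proof.
rewrite (expand_det_row _ ord0) big_ord_recl big_ord_recl big1 => [|i _];
  last by rewrite !mxE /= !mul0r subrr mul0r.
rewrite !mxE /= !mul0r subrr mul0r add0r addr0 mul1r sub0r.
rewrite /cofactor (expand_det_col _ ord0) big_ord_recl big1 => [|i _];
  last by rewrite !mxE /= !mul0r subrr mul0r.
rewrite !mxE /= mul0r mul1r subr0 addr0 /cofactor /=.
set M1 := row' _ _; have -> : M1 = skew_tridiag (fun k => d k.+2) m.
  by apply/matrixP => i j; rewrite !mxE.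
by ring.
Qed.

Lemma det_skew_tridiag (R : comNzRingType) (d : nat -> R) n :
  \det (skew_tridiag d n.*2) = \prod_(k < n) d k.*2 ^+ 2.
Proof.
elim: n d => [|n IHn] d; first by rewrite det_mx00 big_ord0.
by rewrite doubleS det_skew_tridiag_rec IHn big_ord_recl.
Qed.

(** The index [m] may be out of range: it serves as the neighbour [k.+1] of the last index. *)
Lemma sum_delta_nat (R : comPzRingType) N (p : nat -> R) m :
  ((N <= m)%N -> p m = 0) -> \sum_(k < N) (k == m :> nat)%:R * p k = p m.
Proof.
move=> pm0; have [leNm | ltmN] := leqP N m.
  rewrite pm0 // big1 // => k _; case: eqP => [km | _]; last by rewrite mul0r.
  by have := ltn_ord k; rewrite km ltnNge leNm.
rewrite (bigD1 (Ordinal ltmN)) //= eqxx mul1r big1 ?addr0 // => k.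
by rewrite -val_eqE /= => /negPf ->; rewrite mul0r.
Qed.

Definition skew_form {R : pzRingType} (d p q : nat -> R) N :=
  \sum_(k < N) d k * (p k.+1 * q k - p k * q k.+1).

Lemma skew_form_recr (R : pzRingType) (d p q : nat -> R) N :
  skew_form d p q N.+1
    = skew_form d p q N + d N * (p N.+1 * q N - p N * q N.+1).
Proof. exact: big_ord_recr. Qed.

Lemma skew_formxx (R : comPzRingType) (d p : nat -> R) N : skew_form d p p N = 0.
Proof. by apply: big1 => k _; rewrite mulrC mulrBl; ring. Qed.

(** The last term of the form reads the entries at [N], outside the matrix; the hypothesis kills
    them. *)
Lemma skew_formE (R : comPzRingType) (d : nat -> R) (l : nat -> nat -> R) N :
  (forall i, (i < N)%N -> l i N = 0) ->
  let L : 'M_N := \matrix_(i, k) l i k in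
  forall i j : 'I_N,
  (L *m skew_tridiag d N *m L^T) i j = skew_form d (l i) (l j) N.
Proof.
move=> lN L i j; rewrite !mxE.
have l0 (h : 'I_N) k : (k < N)%N -> (N <= k.+1)%N -> l h k.+1 = 0.
  by move=> kN Nk; rewrite -[RHS](lN h) //; congr l; lia.
under eq_bigr => k _.
  rewrite !mxE; under eq_bigr => m _ do
    rewrite !mxE mulrBr (mulrCA (l i m)) (mulrCA (l i m) (k == m.+1 :> nat)%:R).
  rewrite sumrB (sum_delta_nat (p := fun m => l i m * d k)); last first.
    by move/(l0 i _ (ltn_ord k)) ->; rewrite mul0r.
  rewrite mulrBl mulr_suml; over.
rewrite sumrB exchange_big /= /skew_form.
under [X in _ = X]eq_bigr => k _ do rewrite mulrBr.
rewrite sumrB; congr (_ - _); apply: eq_bigr => k _; first by ring.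
under eq_bigr => m _ do rewrite -mulrA.
rewrite (sum_delta_nat (p := fun m => l i k * d k * l j m)); first by ring.
by move/(l0 j _ (ltn_ord k)) ->; rewrite mulr0.
Qed.

Section Array.
Variables (R : comNzRingType) (x rho : R).

(** Column [0] of [L] is [1, rho-1, (rho-1) rho, (rho-1) rho^2, ...], and column
    [1] is [0, 1, rho, rho^2, ...]; the first case below computes the former from
    the previous row without a case distinction on the row index. *)
Definition next_row (p : nat -> R) k :=
  if k is k'.+1 then p k' + p k'.+1 else (rho - 1) * (p 0%N + p 1%N).

Fixpoint array_row i : nat -> R :=
  if i is i'.+1 then next_row (array_row i') else fun k => (k == 0)%:R.

Lemma array_row_gt i k : (i < k)%N -> array_row i k = 0.
Proof.
elim: i k => [|i IHi] [|k] //= ltik.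
by rewrite !IHi ?addr0 // ltnW.
Qed.

Lemma array_row_diag i : array_row i i = 1.
Proof. by elim: i => //= i ->; rewrite array_row_gt ?addr0. Qed.

(** Below row [0], column [0] is [rho - 1] times column [1], so each step multiplies column [1] by
    [(rho - 1) + 1]. *)
Lemma array_row1 i : array_row i.+1 1 = rho ^+ i.
Proof.
elim: i => [|i IHi]; first by rewrite /= addr0.
rewrite exprS -{}IHi /=; ring.
Qed.

(** Coefficients of [1 + (x+rho) t / (1 - (1+x) t)] with [t = u v]. *)
Definition weight k := if k is k'.+1 then (x + rho) * (1 + x) ^+ k' else 1.

(** This is the recurrence of [a] for arbitrary rows, up to a boundary term due to truncation.
    Induction starts at one term because the weights are geometric, of ratio [1 + x], only from
    index [1] on. *)
Lemma skew_form_next_row (p q : nat -> R) M :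
  skew_form weight (next_row p) (next_row q) M.+1
    = skew_form weight p (next_row q) M.+1
      + skew_form weight (next_row p) q M.+1
      + x * skew_form weight p q M.+1
      - weight M.+1 * (p M.+1 * q M - p M * q M.+1).
Proof.
elim: M => [|M IHM].
  by rewrite /skew_form !big_ord_recr !big_ord0 /= expr0; ring.
rewrite !(skew_form_recr _ _ _ M.+1) {}IHM /= exprS; ring.
Qed.

Lemma prod_weight n :
  \prod_(k < n.+1) weight k.*2 ^+ 2
    = (1 + x) ^+ (2 * n ^ 2) * (x + rho) ^+ (2 * n).
Proof.
elim: n => [|n IHn]; first by rewrite big_ord_recr big_ord0 /=; ring.
rewrite big_ord_recr {}IHn /= exprMn -exprM.
rewrite [X in _ * X]mulrC mulrACA -!exprD.
by congr (_ ^+ _ * _ ^+ _); lia.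
Qed.

End Array.

Theorem theorem2 (R : comNzRingType) (x rho : R) (a : nat -> nat -> R)
    (a_rec : forall i j : nat, (1 <= i)%N -> (1 <= j)%N ->
       a i j = a (i - 1)%N j + a i (j - 1)%N + x * a (i - 1)%N (j - 1)%N)
    (a_diag : forall i : nat, a i i = 0)
    (a_col0 : forall i : nat, (1 <= i)%N -> a i 0%N = rho ^+ (i - 1))
    (a_row0 : forall i : nat, (1 <= i)%N -> a 0%N i = - rho ^+ (i - 1))
    (n : nat) (n_ge1 : (1 <= n)%N) :
  \det (\matrix_(i < 2 * n, j < 2 * n) a i j)
    = (1 + x) ^+ (2 * (n - 1) ^ 2) * (x + rho) ^+ (2 * n - 2).
Proof.
pose l := array_row rho; pose d := weight x rho.
(* Row [0] is [1, 0, 0, ...], so only the term [k = 0] survives and leaves column [1]. *)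
have form0 i M : skew_form d (l i.+1) (l 0%N) M.+1 = rho ^+ i.
  rewrite /skew_form big_ord_recl big1 => [|k _];
    last by rewrite /= !mulr0 subrr mulr0.
  by rewrite addr0 -array_row1 /= mul1r mulr1 mulr0 subr0.
have form0r j M : skew_form d (l 0%N) (l j.+1) M.+1 = - rho ^+ j.
  by rewrite -(form0 j M) /skew_form -sumrN; apply: eq_bigr => k _; ring.
(* A common bound [M] keeps the truncation fixed while both indices vary. *)
have aE M i j : (i <= M)%N -> (j <= M)%N -> a i j = skew_form d (l i) (l j) M.+1.
  elim: i j => [|i IHi] j leiM; first case: j => [|j] _.
  - by rewrite a_diag skew_formxx.
  - by rewrite a_row0 // form0r subn1.
  elim: j => [|j IHj] lejM; first by rewrite a_col0 // form0 subn1.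
  rewrite a_rec // !subn1 /= !IHi ?IHj ?(ltnW leiM) ?(ltnW lejM) //.
  rewrite [l i.+1]/= [l j.+1]/= skew_form_next_row.
  (* The boundary term vanishes: rows [i] and [j] are zero at [M.+1]. *)
  by rewrite ![l _ M.+1]array_row_gt 1?ltnW // mul0r mulr0 subrr mulr0 subr0.
case: n n_ge1 => // n _; rewrite mul2n.
pose L : 'M[R]_(n.+1.*2) := \matrix_(i, k) l i k.
have -> : \matrix_(i < n.+1.*2, j < n.+1.*2) a i j
    = L *m skew_tridiag d n.+1.*2 *m L^T.
  apply/matrixP => i j; rewrite skew_formE => [|k]; last exact: array_row_gt.
  by rewrite mxE (aE n.*2.+1) // -ltnS.
have detL : \det L = 1.
  rewrite det_trig; first by apply: big1 => i _; rewrite mxE [l _ _]array_row_diag.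
  by apply/is_trig_mxP => i j ltij; rewrite mxE [l _ _]array_row_gt.
rewrite !det_mulmx det_tr detL mul1r mulr1 det_skew_tridiag prod_weight.
by rewrite -mul2n subn1 mulnS addKn.
Qed.
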